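(* Let $m\ge 2$ and $k\in\mathbb{Z}_+$ be integers, let $X$, $\mu$, $\phi$ be as in the context (a directed graph with one circuit $x_1,\dots,x_\kappa$ and branches $\{x^r_{i,j}\}_{j\in\mathbb N}$, $r\in J_\kappa$, $i\in J_{\eta_r}$, with parent map $\phi$), and suppose that the composition operator $Cf=f\circ\phi$ is a bounded operator on $L^2(\mu)$. Then $C$ is a $k$-quasi-$m$-isometry if and only if both of the following hold: (a) for every $r\in J_\kappa$ and $i\in J_{\eta_r}$, the sequence $\{\mu(x^r_{i,k+j+1})\}_{j=0}^\infty$ is a polynomial in $j$ of degree at most $m-2$; (b) $\sum_{p=0}^{m}(-1)^p\binom{m}{p}h_{p+k}(x_r)=0$ for all $r\in J_\kappa$.
   Context: $\mathbb{N}=\{1,2,\dots\}$, $\mathbb{Z}_+=\{0,1,2,\dots\}$; $J_n=\{1,\dots,n\}$ for $n\in\mathbb N$, $J_0=\emptyset$, $J_\infty=\mathbb N$. Graph: fix $\kappa\in\mathbb N$ and $\eta_r\in\mathbb{Z}_+\cup\{\infty\}$ for $r\in J_\kappa$, at least one $\eta_r$ being nonzero. Let $X=\{x_1,\dots,x_\kappa\}\cup\bigcup_{r=1}^{\kappa}\bigcup_{i=1}^{\eta_r}\{x^r_{i,j}:j\in\mathbb N\}$, all listed points being distinct. For $p\in\mathbb Z$ let $\Phi_1(p)\in\mathbb Z$ and $\Phi_2(p)\in J_\kappa$ be the unique numbers with $p=\Phi_1(p)\kappa+\Phi_2(p)$. The map $\phi:X\to X$ (parent map) is: $\phi(x^r_{i,j+1})=x^r_{i,j}$,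 $\phi(x^r_{i,1})=x_r$, and $\phi(x_{\Phi_2(1+r)})=x_r$ for $r\in J_\kappa$. Measure: $\mathcal F$ is the $\sigma$-algebra of all subsets of $X$ and $\mu$ is a $\sigma$-finite positive measure on $\mathcal F$ with $\mu(\{x\})>0$ for every $x\in X$; write $\mu(x)=\mu(\{x\})$. $L^2(\mu)=L^2(X,\mathcal F,\mu)$ is the complex $L^2$ space. Radon–Nikodym derivatives: for $p\in\mathbb Z_+$, $h_p=d(\mu\circ\phi^{-p})/d\mu$, i.e. $h_p(x)=\mu(\phi^{-p}(\{x\}))/\mu(x)$; $h_0=1$. Explicitly $h_p(x^r_{i,j})=\mu(x^r_{i,j+p})/\mu(x^r_{i,j})$ and $$h_p(x_r)=\frac{1}{\mu(x_r)}\Big(\mu(x_{\Phi_2(p+r)})+\sum_{j=1}^{p}\ \sum_{s\in J_\kappa,\ \Phi_2(p+r)=\Phi_2(s+j)}\ \sum_{i=1}^{\eta_s}\mu(x^s_{i,j})\Big).$$ For a bounded operator $T$ on a complex Hilbert space, $\mathcal B_m(T)=\sum_{j=0}^m(-1)^j\binom mj T^{*(m-j)}T^{m-j}$; $T$ is a $k$-quasi-$m$-isometry if $T^{*k}\mathcal B_m(T)T^k=0$ (for $k=0$ this means $\mathcal B_m(T)=0$, i.e. $T$ is an $m$-isometry). A real sequence $\{\gamma_n\}_{n=0}^\infty$ is a polynomial in $n$ of degree at most $d$ if there is a real polynomial $q$ of degree at most $d$ with $q(n)=\gamma_n$ for all $n\in\mathbb Z_+$. *)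

(* Defs.v *)
From HB Require Import structures.
From mathcomp Require Import all_boot all_order all_algebra complex.
From mathcomp Require Import all_classical all_reals all_analysis.
From mathcomp Require Import measurable_realfun ring lra.

Set Implicit Arguments.
Unset Strict Implicit.
Unset Printing Implicit Defensive.

Import Order.TTheory GRing.Theory Num.Theory.

Local Open Scope classical_set_scope.
Local Open Scope ring_scope.

(* The circuit has length kappa = n.+1.  All indices are shifted so as to start
   at 0: [circ eta r] is x_(r+1) and, for i : branch_index (eta r),
   [branch i j] is x^(r+1)_(i+1, j+1).  [eta r] is [Some c] for c branches at
   [circ eta r] and [None] for infinitely many. *)

Definition branch_index (e : option nat) : Type :=
  {i : nat | if e is Some c then (i < c)%N else true}.

Inductive vertex (n : nat) (eta : 'I_n.+1 -> option nat) : Type :=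
| circ of 'I_n.+1
| branch (r : 'I_n.+1) of branch_index (eta r) & nat.

Arguments circ {n} eta _.
Arguments branch {n eta r} _ _.

Section Vertex.
Variables (n : nat) (eta : 'I_n.+1 -> option nat).

Definition parent (x : vertex eta) : vertex eta :=
  match x with
  | circ r => circ eta (ord_pred r)
  | @branch _ _ r i j => if j is j'.+1 then branch i j' else circ eta r
  end.

(* The circuit is oriented so that x_(r+1) has parent x_r, cyclically. *)
Lemma parent_circ_ordS (r : 'I_n.+1) : parent (circ eta (ordS r)) = circ eta r.
Proof. by rewrite /= ordSK. Qed.

HB.instance Definition _ := gen_eqMixin (vertex eta).
HB.instance Definition _ := gen_choiceMixin (vertex eta).
HB.instance Definition _ := isPointed.Build (vertex eta) (circ eta ord0).
HB.instance Definition _ := @isMeasurable.Build default_measure_display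
  (vertex eta) discrete_measurable discrete_measurable0
  discrete_measurableC discrete_measurableU.

End Vertex.

(* Elements of [L2 mu] are functions, not classes modulo almost everywhere
   equality.  This is the usual complex L^2 when every nonempty measurable set
   has positive measure, as for the measures on [vertex eta] that charge every
   point. *)

Section L2.
Context d (T : measurableType d) (R : realType).
Variable mu : {measure set T -> \bar R}.
Implicit Types f g : T -> R[i].

Definition normc2 (z : R[i]) : R := complex.Re z ^+ 2 + complex.Im z ^+ 2.

Definition square_integrable f : Prop :=
  [/\ measurable_fun setT (@complex.Re R \o f),
      measurable_fun setT (@complex.Im R \o f) &
      (\int[mu]_x (normc2 (f x))%:E < +oo)%E].

Definition L2_pred : {pred T -> R[i]} := mem [set f | square_integrable f].

Lemma normc2_ge0 z : 0 <= normc2 z.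
Proof. by rewrite addr_ge0 ?sqr_ge0. Qed.

Lemma normc2M z w : normc2 (z * w) = normc2 z * normc2 w.
Proof. by case: z w => [a b] [c e]; rewrite /normc2 /=; ring. Qed.

Lemma normc2D_le z w : normc2 (z + w) <= 2 * normc2 z + 2 * normc2 w.
Proof.
case: z w => [a b] [c e]; rewrite /normc2 /=.
have := sqr_ge0 (a - c); have := sqr_ge0 (b - e); nra.
Qed.

Lemma Re_mulD (a z w : R[i]) : complex.Re (a * z + w) =
  complex.Re a * complex.Re z - complex.Im a * complex.Im z + complex.Re w.
Proof. by case: a z w => [? ?] [? ?] [? ?]. Qed.

Lemma Im_mulD (a z w : R[i]) : complex.Im (a * z + w) =
  complex.Re a * complex.Im z + complex.Im a * complex.Re z + complex.Im w.
Proof. by case: a z w => [? ?] [? ?] [? ?]. Qed.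

Lemma measurable_normc2 f : measurable_fun setT (@complex.Re R \o f) ->
  measurable_fun setT (@complex.Im R \o f) ->
  measurable_fun setT (EFin \o (@normc2 \o f)).
Proof.
by move=> mr mi; apply/measurable_EFinP; apply: measurable_funD;
  exact: measurable_funX.
Qed.

Lemma L2_submod_closed : submod_closed L2_pred.
Proof.
split.
  rewrite inE; split; [exact: measurable_cst|exact: measurable_cst|].
  under eq_integral do rewrite /normc2 /= expr0n addr0.
  by rewrite integral0 ltry.
move=> a f g; rewrite !inE => -[fr fi ff] [gr gi gf].
have hr : measurable_fun setT (@complex.Re R \o (a *: f + g)).
  rewrite (_ : _ \o _ = (fun x => (complex.Re a * complex.Re (f x) -
      complex.Im a * complex.Im (f x)) + complex.Re (g x))); last first.
    by apply/funext => x /=; exact: Re_mulD.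
  apply: measurable_funD => //; apply: measurable_funB;
    exact: measurable_funM.
have hi : measurable_fun setT (@complex.Im R \o (a *: f + g)).
  rewrite (_ : _ \o _ = (fun x => (complex.Re a * complex.Im (f x) +
      complex.Im a * complex.Re (f x)) + complex.Im (g x))); last first.
    by apply/funext => x /=; exact: Im_mulD.
  apply: measurable_funD => //; apply: measurable_funD;
    exact: measurable_funM.
split=> //.
have mf := measurable_normc2 fr fi; have mg := measurable_normc2 gr gi.
have c0 : 0 <= 2 * normc2 a by rewrite mulr_ge0 ?normc2_ge0.
have pos f' x : setT x -> (0 <= (normc2 (f' x))%:E :> \bar R)%E.
  by rewrite lee_fin normc2_ge0.
have posM c f' x : 0 <= c -> setT x -> (0 <= c%:E * (normc2 (f' x))%:E :> \bar R)%E.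
  by move=> ? _; rewrite -EFinM lee_fin mulr_ge0 ?normc2_ge0.
have mM c f' : measurable_fun setT (EFin \o (@normc2 \o f')) ->
    measurable_fun setT (fun x => c%:E * (normc2 (f' x))%:E)%E.
  by move=> mf'; exact: measurable_funeM.
apply: (@le_lt_trans _ _ (\int[mu]_x ((2 * normc2 a)%:E * (normc2 (f x))%:E
                              + 2%:E * (normc2 (g x))%:E))%E).
  apply: ge0_le_integral; [exact: measurableT|by move=> x; exact: pos| | |].
  - exact: measurable_normc2.
  - by apply: emeasurable_funD; exact: mM.
  - move=> x _; rewrite -!EFinM -EFinD lee_fin.
    by rewrite (le_trans (normc2D_le _ _))// normc2M mulrA.
rewrite ge0_integralD//; [|by move=> x ?; exact: posM|exact: mM
                         |by move=> x ?; exact: posM|exact: mM].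
rewrite !ge0_integralZl//; [|by move=> x; exact: pos..].
by rewrite lte_add_pinfty// lte_mul_pinfty// ?lee_fin.
Qed.

HB.instance Definition _ :=
  GRing.isSubmodClosed.Build R[i] (T -> R[i]) L2_pred L2_submod_closed.

Record L2 : Type := MkL2 { L2_fun :> T -> R[i] ; _ : L2_fun \in L2_pred }.

HB.instance Definition _ := [isSub for L2_fun].
HB.instance Definition _ := gen_eqMixin L2.
HB.instance Definition _ := [Choice of L2 by <:].
HB.instance Definition _ := [SubChoice_isSubLmodule of L2 by <:].

Definition integralC (f : T -> R[i]) : R[i] :=
  Complex (\int[mu]_x complex.Re (f x)) (\int[mu]_x complex.Im (f x)).

Definition L2_dot (f g : L2) : R[i] := integralC (fun x => f x * conjc (g x)).

End L2.

Section Operators.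
Variables (R : realType) (V : lmodType R[i]) (dot : V -> V -> R[i]).
Implicit Types (T : V -> V) (u v w : V).

Definition hnorm u : R := Num.sqrt (complex.Re (dot u u)).

Definition bounded_operator T : Prop :=
  linear T /\ exists M : R, forall u, hnorm (T u) <= M * hnorm u.

(* On a Hilbert space and for a bounded T, the set below is a singleton by the
   Riesz representation theorem, so the default value 0 is never used. *)
Definition adjoint T : V -> V :=
  fun v => xget 0 [set w | forall u, dot (T u) v = dot u w].

Definition defect (m : nat) T : V -> V := fun u =>
  \sum_(j < m.+1) ((-1) ^+ j * 'C(m, j)%:R) *:
    iter (m - j) (adjoint T) (iter (m - j) T u).

Definition quasi_isometry (k m : nat) T : Prop :=
  forall u, iter k (adjoint T) (defect m T (iter k T u)) = 0.

End Operators.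

Section Composition.
Variables (R : realType) (n : nat) (eta : 'I_n.+1 -> option nat).
Variable mu : {measure set (vertex eta) -> \bar R}.

Definition mass (x : vertex eta) : R := fine (mu [set x]).

(* The quotient is formed in R: if C is bounded, then the fibre has finite
   measure, its indicator being C^p applied to that of x. *)
Definition RN (p : nat) (x : vertex eta) : R :=
  fine (mu (iter p (@parent n eta) @^-1` [set x])) / mass x.

Definition is_composition_operator (C : L2 mu -> L2 mu) : Prop :=
  forall (f : L2 mu) (x : vertex eta), C f x = f (parent x).

End Composition.

Definition polynomial_seq (R : realType) (d : nat) (gamma : nat -> R) : Prop :=
  exists q : {poly R}, (size q <= d.+1)%N /\ forall j : nat, q.[j%:R] = gamma j.

(* Main.v *)
Require Import Defs.
From mathcomp Require Import all_boot all_order all_algebra complex.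
From mathcomp Require Import all_classical all_reals all_analysis.
From mathcomp Require Import measurable_realfun ring lra zify.

(* The change of variables [\int g o phi^p = \int g * h_p] gives
   C^*(h_p . C u) = h_{p+1} . u, hence C^{*k} B_m(C) C^k is multiplication by the
   function sum_p +-binom(m, p) h_{m-p+k}, and C is a k-quasi-m-isometry iff the
   m-th difference of p |-> h_p(x) vanishes at p = k for all x.  At the vertices
   of a branch this makes gamma_j = mu(x_{k+j+1}) a polynomial of degree at most
   m - 1.  To gain one degree, note that a k-quasi-m-isometry is also a
   (k+l)-quasi-m-isometry, so that p |-> h_{k+p}(x_r) is a polynomial of degree at
   most m - 1.  One turn around the circuit adds to the fibre of x_r a vertex of
   the branch, so gamma_{p+kappa-1} is bounded by
   mu(x_r) (h_{k+p+kappa}(x_r) - h_{k+p}(x_r)), of degree at most m - 2. *)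

Set Implicit Arguments.
Unset Strict Implicit.
Unset Printing Implicit Defensive.

Import Order.TTheory GRing.Theory Num.Theory.

Local Open Scope classical_set_scope.
Local Open Scope ring_scope.

(** * Backward differences and polynomial sequences *)

Section BackwardDifference.
Variable R : realType.
Implicit Types (s t : nat -> R) (q : {poly R}).

(* [bdiff m] is (1 - S)^m for the shift S, that is (-1)^m times the m-th forward
   difference; this avoids the sign in [bdiffE]. *)
Fixpoint bdiff (m : nat) s : nat -> R :=
  if m is m'.+1 then bdiff m' (fun j => s j - s j.+1) else s.

Lemma eq_bdiff m s t : s =1 t -> bdiff m s =1 bdiff m t.
Proof. by move=> /funext ->. Qed.

Lemma bdiffB m s t j : bdiff m (fun j => s j - t j) j = bdiff m s j - bdiff m t j.
Proof.
elim: m s t j => //= m IH s t j; rewrite -IH.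
by apply: eq_bdiff => i; ring.
Qed.

Lemma bdiffZ m c s j : bdiff m (fun j => c * s j) j = c * bdiff m s j.
Proof.
elim: m s j => //= m IH s j; rewrite -IH.
by apply: eq_bdiff => i; rewrite mulrBr.
Qed.

Lemma bdiff_shift m s i j : bdiff m (fun j => s (j + i)%N) j = bdiff m s (j + i).
Proof. by elim: m s j => //= m IH s j; rewrite -IH. Qed.

Lemma bdiffS m s j : bdiff m.+1 s j = bdiff m s j - bdiff m s j.+1.
Proof.
rewrite /= bdiffB -[j.+1]addn1 -bdiff_shift; congr (_ - _).
by apply: eq_bdiff => i; rewrite addn1.
Qed.

Lemma bdiffE m s j :
  bdiff m s j = \sum_(p < m.+1) (-1) ^+ p * 'C(m, p)%:R * s (p + j)%N.
Proof.
elim: m j => [|m IH] j; first by rewrite big_ord1 expr0 bin0 !mul1r.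
rewrite bdiffS !IH [RHS]big_ord_recl /= [in LHS]big_ord_recl /= !bin0 -addrA.
congr (_ + _).
(* A zero term with C(m, m + 1) lengthens this sum to the range of the other one, for Pascal's
   rule. *)
have -> : \sum_(i < m) (-1) ^+ (bump 0 i) * 'C(m, bump 0 i)%:R * s (bump 0 i + j)%N
   = \sum_(i < m.+1) (-1) ^+ i.+1 * 'C(m, i.+1)%:R * s (i.+1 + j)%N.
  by rewrite [RHS]big_ord_recr /= bin_small// mulr0 mul0r addr0.
rewrite -sumrB; apply: eq_bigr => i _.
by rewrite /bump /= add1n binS natrD addSnnS exprS; ring.
Qed.

Lemma bdiff_const s j : (forall i, bdiff 1 s i = 0) -> s j = s 0%N.
Proof. by move=> h; elim: j => // j <-; have /eqP := h j; rewrite subr_eq0 => /eqP. Qed.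

(** Passing from q to q - q(X + 1) cancels the leading coefficient, so every difference lowers the
    size bound by one. *)
Lemma bdiff_poly d q j : (size q <= d)%N -> bdiff d (fun i => q.[i%:R]) j = 0.
Proof.
elim: d q j => [|d IH] q j sq.
  by move: sq; rewrite leqn0 size_poly_eq0 => /eqP ->; rewrite /= horner0.
rewrite /= (@eq_bdiff d _ (fun i => (q - (q \Po ('X + 1%:P))).[i%:R])); last first.
  by move=> i /=; rewrite hornerD hornerN horner_comp !hornerE natr1.
apply: IH; apply/leq_sizeP => i di.
have s' : size (q \Po ('X + 1%:P)) = size q.
  by rewrite size_comp_poly2// size_XaddC.
rewrite coefB; have [ie|ne] := eqVneq i d; last first.
  rewrite !nth_default ?subr0// ?s'; first by rewrite (leq_trans sq)// ltn_neqAle eq_sym ne.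
  by rewrite (leq_trans sq)// ltn_neqAle eq_sym ne.
have [sq'|] := leqP (size q) d; first by rewrite !nth_default ?subr0// ?s' ?ie.
move=> dq; have sqE : size q = d.+1 by apply/eqP; rewrite eqn_leq sq.
have := lead_coef_comp q (q := 'X + 1%:P) ; rewrite size_XaddC => /(_ isT).
rewrite lead_coefXaddC expr1n mulr1 /lead_coef s' sqE /= ie => ->.
by rewrite subrr.
Qed.

(** Newton's basis, built from (i + 1) C(j, i + 1) = (j - i) C(j, i). *)
Lemma bin_poly i : exists2 q : {poly R}, (size q <= i.+1)%N &
  forall j : nat, q.[j%:R] = 'C(j, i)%:R.
Proof.
elim: i => [|i [q sq qE]].
  by exists 1; [rewrite size_poly1|move=> j; rewrite hornerC bin0].
exists (i.+1%:R^-1 *: (q * ('X - i%:R%:P))).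
  rewrite (leq_trans (size_scale_leq _ _))// (leq_trans (size_polyMleq _ _))//.
  by rewrite size_XsubC addn2.
move=> j; rewrite hornerZ hornerM hornerXsubC qE.
have [ij|ji] := leqP i j; last first.
  by rewrite (bin_small ji) (bin_small (leqW ji)) mul0r mulr0.
rewrite -natrB// -natrM mulnC -mul_bin_left natrM mulrA mulVf ?mul1r//.
Qed.

(** By Pascal's rule 1 - S sends C(j, i + 1) to -C(j, i). *)
Lemma bdiff_bin d (i j : nat) :
  bdiff d (fun j => 'C(j, d + i)%:R) j = (-1) ^+ d * 'C(j, i)%:R :> R.
Proof.
elim: d j => [|d IH] j; first by rewrite mul1r.
rewrite /= (@eq_bdiff d _ (fun j => -1 * 'C(j, d + i)%:R)); last first.
  by move=> l; rewrite addSn binS natrD; ring.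
by rewrite bdiffZ IH exprS mulrA.
Qed.

(** The converse is Newton interpolation: subtract the multiple of C(j, e) that cancels the constant
    top difference, and induct. *)
Lemma polynomial_seqP d s :
  polynomial_seq d s <-> forall j, bdiff d.+1 s j = 0.
Proof.
split=> [[q [sq qE]] j|].
  by rewrite -(@bdiff_poly d.+1 q j sq); apply: eq_bdiff => i; rewrite qE.
(* A size bound e in place of e + 1 lets the induction start from the zero sequence. *)
suff main e : (forall j, bdiff e s j = 0) ->
    exists q : {poly R}, (size q <= e)%N /\ forall j : nat, q.[j%:R] = s j.
  exact: main.
elim: e s => [|e IH] {}s h.
  by exists 0; rewrite size_poly0; split=> // j; rewrite horner0; exact/esym/h.
have [b sb bE] := bin_poly e.
(* The e-th difference of C(j, e) is (-1)^e, whence the sign. *)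
pose c := (-1) ^+ e * bdiff e s 0%N.
have [|q [sq qE]] := IH (fun j => s j - c * 'C(j, e)%:R).
  move=> j; have := bdiff_bin e 0 j; rewrite addn0 bin0 mulr1 bdiffB bdiffZ => ->; rewrite /c.
  rewrite mulrAC -expr2 -exprM mulnC exprM sqrrN !expr1n mul1r.
  rewrite (@bdiff_const (bdiff e s)) ?subrr// => i; rewrite [LHS]/= -bdiffS; exact: h.
exists (q + c *: b); split.
  rewrite (leq_trans (size_polyD _ _))// geq_max (leqW sq)/=.
  by rewrite (leq_trans (size_scale_leq _ _)).
by move=> j; rewrite hornerD hornerZ qE bE subrK.
Qed.

(* Contrapositive: if the d-th forward difference is bounded above by a negative
   constant, so are eventually the lower ones, down to [s] itself. *)
Lemma bdiff_ge0 d s c : (forall j, 0 <= s j) ->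
  (forall j, (-1) ^+ d * bdiff d s j = c) -> 0 <= c.
Proof.
move=> s0 sc; rewrite leNgt; apply/negP => c0.
have : exists N, forall j, (N <= j)%N -> (-1) ^+ d * bdiff d s j <= c.
  by exists 0%N => j _; rewrite sc.
elim: d {sc} => [[N /(_ N (leqnn N))]|d IH [N hN]].
  by rewrite mul1r /= => h; have := s0 N; lra.
apply: IH; pose u j := (-1) ^+ d * bdiff d s j.
have uS j : (N <= j)%N -> u j.+1 <= u j + c.
  move=> /hN; rewrite bdiffS exprS /u; lra.
have ub i : u (i + N)%N <= u N + c * i%:R.
  elim: i => [|i ih]; first by rewrite mulr0 addr0.
  rewrite addSn (le_trans (uS _ (leq_addl _ _)))// -natr1; lra.
(* From N on, [u] drops by at least -c > 0 at each step, so more than |u N - c| / -c steps bring it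
   down to c or below. *)
pose B := Num.truncn (`|u N - c| / - c).
exists (N + B.+1)%N => j hj.
have := ub (j - N)%N; rewrite subnK; last by rewrite (leq_trans _ hj)// leq_addr.
move=> /le_trans; apply.
have : `|u N - c| / - c < B.+1%:R by rewrite truncnS_gt.
have : B.+1%:R <= (j - N)%:R :> R by rewrite ler_nat; lia.
rewrite ltr_pdivrMr ?oppr_gt0//; have := ler_norm (u N - c); nra.
Qed.

End BackwardDifference.

(** * Inner product, adjoints and indicators in L^2(mu) *)

Section L2Theory.
Context d (T : measurableType d) (R : realType).
Variable mu : {measure set T -> \bar R}.
Implicit Types (u v w : L2 mu) (f g : T -> R[i]).
Local Notation dot := (@L2_dot _ _ _ mu).

Lemma L2P u : square_integrable mu u.
Proof. by case: u => f /=; rewrite inE. Qed.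

Lemma L2_ext u v : u =1 v -> u = v.
Proof. by move=> uv; apply/val_inj/funext. Qed.

Lemma L2_linE (a : R[i]) u v x : (a *: u + v : L2 mu) x = a * u x + v x.
Proof. by []. Qed.

Lemma Re_mulc (z w : R[i]) : complex.Re (z * conjc w) =
  complex.Re z * complex.Re w + complex.Im z * complex.Im w.
Proof. by case: z w => [? ?] [? ?] /=; ring. Qed.

Lemma Im_mulc (z w : R[i]) : complex.Im (z * conjc w) =
  complex.Im z * complex.Re w - complex.Re z * complex.Im w.
Proof. by case: z w => [? ?] [? ?] /=; ring. Qed.

Lemma normc2_integrable u : mu.-integrable setT (EFin \o (@normc2 R \o u)).
Proof.
have [ur ui uf] := L2P u; apply/integrableP; split.
  exact: measurable_normc2.
by under eq_integral do rewrite /= ger0_norm ?normc2_ge0//.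
Qed.

(** Both parts are bounded by |u|^2 + |v|^2, as 2|ab| <= a^2 + b^2. *)
Lemma L2_mulc_integrable u v :
  mu.-integrable setT (EFin \o (fun x => complex.Re (u x * conjc (v x)))) /\
  mu.-integrable setT (EFin \o (fun x => complex.Im (u x * conjc (v x)))).
Proof.
have [[ur ui _] [vr vi _]] := (L2P u, L2P v).
have huv := integrableD measurableT (normc2_integrable u) (normc2_integrable v).
split; apply: (le_integrable measurableT _ _ huv).
- apply/measurable_EFinP.
  rewrite (_ : (fun x => _) = (fun x => complex.Re (u x) * complex.Re (v x) +
    complex.Im (u x) * complex.Im (v x))); last first.
    by apply/funext => x; rewrite Re_mulc.
  by apply: measurable_funD; exact: measurable_funM.
- move=> x _ /=; rewrite lee_fin Re_mulc [leRHS]ger0_norm ?(addr_ge0 (normc2_ge0 _) (normc2_ge0 _))//.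
  case: (u x) (v x) => [a b] [c e]; rewrite /normc2 /= ler_norml.
  have := sqr_ge0 (a - c); have := sqr_ge0 (b - e).
  have := sqr_ge0 (a + c); have := sqr_ge0 (b + e).
  move=> *; apply/andP; split; nra.
- apply/measurable_EFinP.
  rewrite (_ : (fun x => _) = (fun x => complex.Im (u x) * complex.Re (v x) -
    complex.Re (u x) * complex.Im (v x))); last first.
    by apply/funext => x; rewrite Im_mulc.
  by apply: measurable_funB; exact: measurable_funM.
- move=> x _ /=; rewrite lee_fin Im_mulc [leRHS]ger0_norm ?(addr_ge0 (normc2_ge0 _) (normc2_ge0 _))//.
  case: (u x) (v x) => [a b] [c e]; rewrite /normc2 /= ler_norml.
  have := sqr_ge0 (b - c); have := sqr_ge0 (a - e).
  have := sqr_ge0 (b + c); have := sqr_ge0 (a + e).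
  move=> *; apply/andP; split; nra.
Qed.

Lemma L2_dot_linr u (a : R[i]) v w :
  dot u (a *: v + w) = conjc a * dot u v + dot u w.
Proof.
have [vr vi] := L2_mulc_integrable u v; have [wr wi] := L2_mulc_integrable u w.
case: a => [a b]; have iZ c (f : T -> R) : mu.-integrable setT (EFin \o f) ->
    mu.-integrable setT (EFin \o (fun x => c * f x)).
  by move=> h; exact: (integrableZl measurableT c h).
apply/eqP; rewrite eq_complex /=; apply/andP; split; apply/eqP.
- rewrite /= mulNr opprK -!RintegralZl// -!RintegralD//; last 3 first.
  + by apply: (integrableD measurableT (f := EFin \o _) (g := EFin \o _)); exact: iZ.
  + exact: iZ.
  + exact: iZ.
  apply: eq_Rintegral => x _; rewrite (_ : conjc _ = conjc (Complex a b * v x + w x))//.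
  by case: (u x) (v x) (w x) => [? ?] [? ?] [? ?] /=; ring.
- rewrite -!RintegralZl// -!RintegralD//; last 3 first.
  + by apply: (integrableD measurableT (f := EFin \o _) (g := EFin \o _)); exact: iZ.
  + exact: iZ.
  + exact: iZ.
  apply: eq_Rintegral => x _; rewrite (_ : conjc _ = conjc (Complex a b * v x + w x))//.
  by case: (u x) (v x) (w x) => [? ?] [? ?] [? ?] /=; ring.
Qed.

(** As a relation, adjointness is linear in the pair [(v, w)] and can be checked before [adjoint] is
    known to take the value [w]. *)
Definition has_adjoint (S : L2 mu -> L2 mu) v w : Prop :=
  forall u, dot (S u) v = dot u w.

Lemma L2_dot0r u : dot u 0 = 0.
Proof.
have := L2_dot_linr u (-1) 0 0; rewrite scaler0 addr0.
by rewrite rmorphN1 mulN1r addNr.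
Qed.

Lemma has_adjoint_sum S (I : Type) (r : seq I) (c : I -> R[i]) (v w : I -> L2 mu) :
  (forall i, has_adjoint S (v i) (w i)) ->
  has_adjoint S (\sum_(i <- r) c i *: v i) (\sum_(i <- r) c i *: w i).
Proof.
move=> h u; elim: r => [|i r IH]; first by rewrite !big_nil !L2_dot0r.
by rewrite !big_cons !L2_dot_linr IH h.
Qed.

Lemma square_integrable_indic (A : set T) : measurable A ->
  square_integrable mu (fun x => (\1_A x)%:C%C) <-> (mu A < +oo)%E.
Proof.
move=> mA.
have E : (\int[mu]_x (normc2 ((\1_A x)%:C%C : R[i]))%:E)%E = mu A.
  rewrite -[in RHS](setIT A) -integral_indic//; apply: eq_integral => x _.
  by rewrite /normc2 /= indicE; case: (x \in A); rewrite ?expr1n ?expr0n /= ?addr0.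
split=> [[_ _]|fA]; first by rewrite E.
by split; rewrite ?E//; [exact: measurable_indic|exact: measurable_cst].
Qed.

(** The default 0 is never met: values are read through [L2_ofE], given square integrability. *)
Definition L2_of f : L2 mu := insubd (0 : L2 mu) f.

Lemma L2_ofE f : square_integrable mu f -> L2_of f = f :> (T -> R[i]).
Proof. by move=> sf; rewrite [LHS]insubdK// inE. Qed.

Lemma square_integrable_bounded (h : T -> R) (B : R) u : measurable_fun setT h ->
  (forall x, `|h x| <= B) -> square_integrable mu (fun x => (h x)%:C%C * u x).
Proof.
move=> mh hB; have [ur ui uf] := L2P u.
have mr : measurable_fun setT (@complex.Re R \o (fun x => (h x)%:C%C * u x)).
  rewrite (_ : _ \o _ = (fun x => h x * complex.Re (u x))).
    exact: measurable_funM.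
  by apply/funext => x /=; case: (u x) => [? ?] /=; rewrite mul0r subr0.
have mi : measurable_fun setT (@complex.Im R \o (fun x => (h x)%:C%C * u x)).
  rewrite (_ : _ \o _ = (fun x => h x * complex.Im (u x))).
    exact: measurable_funM.
  by apply/funext => x /=; case: (u x) => [? ?] /=; rewrite mul0r addr0.
split=> //.
have B2 x : h x ^+ 2 <= B ^+ 2.
  by rewrite -real_normK ?num_real// lerXn2r ?nnegrE// (le_trans _ (hB x)).
apply: (@le_lt_trans _ _ (\int[mu]_x ((B ^+ 2)%:E * (normc2 (u x))%:E))%E).
  apply: ge0_le_integral => //.
  - by move=> x _; rewrite lee_fin normc2_ge0.
  - exact: measurable_normc2.
  - by apply: measurable_funeM; exact: measurable_normc2.
  - move=> x _; rewrite -EFinM lee_fin normc2M ler_wpM2r ?normc2_ge0//.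
    by rewrite /normc2 /= expr0n addr0.
rewrite ge0_integralZl//; last by rewrite lee_fin sqr_ge0.
- by rewrite lte_mul_pinfty// lee_fin sqr_ge0.
- exact: measurable_normc2.
- by move=> x _; rewrite lee_fin normc2_ge0.
Qed.

Lemma hnorm_indic (A : set T) u : measurable A ->
  (forall x, u x = (\1_A x)%:C%C) -> hnorm dot u = Num.sqrt (fine (mu A)).
Proof.
move=> mA uA; rewrite /hnorm /L2_dot /integralC /= /Rintegral; congr (Num.sqrt (fine _)).
rewrite -[in RHS](setIT A) -integral_indic//; apply: eq_integral => x _.
by rewrite uA Re_mulc /= mulr0 addr0 indicE; case: (x \in A); rewrite ?mulr1 ?mulr0.
Qed.

End L2Theory.

(** * Change of variables along iterates of the parent map *)

Section VertexMeasure.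
Variables (R : realType) (n : nat) (eta : 'I_n.+1 -> option nat).
Variable mu : {measure set (vertex eta) -> \bar R}.
Local Notation X := (vertex eta).
Local Notation phi := (@parent n eta).

Lemma vertex_countable : exists e : X -> nat, injective e.
Proof.
pose enc (x : X) : 'I_n.+1 + 'I_n.+1 * nat * nat := match x with
  | circ r => inl r | branch r i j => inr (r, sval i, j) end.
exists (pickle \o enc); apply: inj_comp; first exact: (pcan_inj (@pickleK _)).
move=> [r|r i j] [r'|r' i' j'] //= []; first by move=> ->.
move=> rr ii ->; subst r'; case: i i' ii => [i pi] [i' pi'] /= ii.
by subst i'; rewrite (Prop_irrelevance pi pi').
Qed.

(** [X] is countable, so integrals over it split into countably many integrals over fibres. *)
Lemma ge0_eq_integral_fibers (psi : X -> X) (f g : X -> \bar R) :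
  (forall x, (0 <= f x)%E) -> (forall x, (0 <= g x)%E) ->
  (forall x, (\int[mu]_(y in psi @^-1` [set x]) f y =
              \int[mu]_(y in [set x]) g y)%E) ->
  (\int[mu]_x f x = \int[mu]_x g x)%E.
Proof.
move=> f0 g0 fg; have [e einj] := vertex_countable.
(* The pieces are indexed by codes under [e]; [ps] is [psi] for [f] and [id] for [g], and a code not
   attained contributes 0. *)
have split (ps : X -> X) (h : X -> \bar R) : (forall x, (0 <= h x)%E) ->
    (\int[mu]_x h x =
     \sum_(0 <= i <oo) \int[mu]_(x in ps @^-1` (e @^-1` [set i])) h x)%E.
  move=> h0; rewrite -ge0_integral_bigcup//.
  - by congr integral; apply/seteqP; split => // x _; exists (e (ps x)).
  - by move=> i j _ _ [x [/= <- <-]].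
rewrite (split psi f f0) (split id g g0); apply: eq_eseriesr => i _.
have [[x ex]|nx] := pselect (exists x, e x = i).
  have -> : e @^-1` [set i] = [set x].
    by apply/seteqP; split => y /=; rewrite -ex; [exact: einj|by move=> ->].
  exact: fg.
have -> : e @^-1` [set i] = set0.
  by apply/seteqP; split => // y ey; apply: nx; exists y.
by rewrite preimage_set0 !integral_set0.
Qed.

Hypothesis mu_gt0 : forall x : X, (0 < mu [set x])%E.
Hypothesis mu_fin : forall x : X, (mu [set x] < +oo)%E.

Lemma massE x : mu [set x] = (mass mu x)%:E.
Proof. by rewrite /mass fineK// ge0_fin_numE. Qed.

Lemma mass_gt0 x : 0 < mass mu x.
Proof. by rewrite -lte_fin -massE. Qed.

Definition fiber (p : nat) (x : X) : set X := iter p phi @^-1` [set x].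

Lemma RN_ge0 p x : 0 <= RN mu p x.
Proof. by rewrite /RN divr_ge0 ?fine_ge0// ltW// mass_gt0. Qed.

Lemma RN0 x : RN mu 0 x = 1.
Proof. by rewrite /RN -/(mass mu x) divff// gt_eqF// mass_gt0. Qed.

Lemma Rintegral_iter_parent p (g : X -> R) :
  (forall x, (mu (fiber p x) < +oo)%E) ->
  \int[mu]_x g (iter p phi x) = \int[mu]_x (g x * RN mu p x).
Proof.
move=> fin.
(* On the fibre of [x] the left integrand is the constant [h x], and the fibre has mass [RN mu p x]
   times that of [x]. *)
have key (h : X -> R) : (forall x, 0 <= h x) ->
    (\int[mu]_x (h (iter p phi x))%:E = \int[mu]_x (h x * RN mu p x)%:E)%E.
  move=> h0; apply: (@ge0_eq_integral_fibers (iter p phi)).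
  - by move=> x; rewrite lee_fin.
  - by move=> x; rewrite lee_fin mulr_ge0// RN_ge0.
  move=> x; transitivity (\int[mu]_(y in fiber p x) (cst (h x)%:E) y)%E.
    by apply: eq_integral => y; rewrite inE => <-.
  rewrite integral_cst//; transitivity (\int[mu]_(y in [set x])
      (cst (h x * RN mu p x)%:E) y)%E; last first.
    by apply: eq_integral => y; rewrite inE => ->.
  rewrite integral_cst// massE -EFinM -mulrA /RN divfK ?gt_eqF ?mass_gt0//.
  by rewrite EFinM fineK// ge0_fin_numE// fin.
(* Multiplication by the nonnegative [RN mu p] commutes with positive and negative parts, so [key]
   applies to each. *)
rewrite /Rintegral; congr fine; rewrite integralE [RHS]integralE.
congr (_ - _)%E.
- under eq_integral do rewrite funeposE -EFin_max.
  rewrite (key (fun x => Num.max (g x) 0)); last by move=> x; rewrite le_max lexx orbT.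
  apply: eq_integral => x _.
  by rewrite funeposE -EFin_max maxr_pMl ?RN_ge0// mul0r.
- under eq_integral do rewrite funenegE -EFinN -EFin_max.
  rewrite (key (fun x => Num.max (- g x) 0)); last by move=> x; rewrite le_max lexx orbT.
  apply: eq_integral => x _.
  by rewrite funenegE -EFinN -EFin_max maxr_pMl ?RN_ge0// mul0r mulNr.
Qed.

(** * Powers of the composition operator and of its adjoint *)

Variable C : L2 mu -> L2 mu.
Hypothesis hC : is_composition_operator C.
Hypothesis hbounded : bounded_operator (@L2_dot _ _ _ mu) C.
Local Notation dot := (@L2_dot _ _ _ mu).

Lemma iterCE p (u : L2 mu) x : iter p C u x = u (iter p phi x).
Proof. by elim: p x => // p IH x; rewrite iterS hC IH -iterSr. Qed.

Lemma hnorm_iter : exists2 M : R, 0 <= M & forall p (u : L2 mu),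
  hnorm dot (iter p C u) <= M ^+ p * hnorm dot u.
Proof.
have [_ [M hM]] := hbounded; exists `|M| => // p u.
elim: p => [|p IH]; first by rewrite mul1r.
rewrite iterS exprS -mulrA (le_trans (hM _))//.
by rewrite (le_trans (ler_wpM2r (sqrtr_ge0 _) (ler_norm M)))// ler_wpM2l.
Qed.

Lemma iterC_indic p x (y : X) :
  iter p C (L2_of mu (fun y => (\1_[set x] y)%:C%C)) y = (\1_(fiber p x) y)%:C%C.
Proof. by rewrite iterCE L2_ofE//; exact/square_integrable_indic. Qed.

(** The indicator of the fibre is C^p of the indicator of x, hence square integrable. *)
Lemma fiber_fin p x : (mu (fiber p x) < +oo)%E.
Proof.
apply/square_integrable_indic => //.
have := L2P (iter p C (L2_of mu (fun y => (\1_[set x] y)%:C%C))).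
have -> // : L2_fun (iter p C (L2_of mu (fun y => (\1_[set x] y)%:C%C))) =
  (fun y => (\1_(fiber p x) y)%:C%C) by apply/funext => y; exact: iterC_indic.
Qed.

(** At the indicator of x, the squared norm bound on C^p reads mu(fiber p x) <= M^(2p) mu(x). *)
Lemma RN_bounded p : exists B, forall x, `|RN mu p x| <= B.
Proof.
have [M M0 hM] := hnorm_iter; exists ((M ^+ p) ^+ 2) => x.
rewrite ger0_norm ?RN_ge0// /RN ler_pdivrMr ?mass_gt0//.
have := hM p (L2_of mu (fun y => (\1_[set x] y)%:C%C)).
rewrite (hnorm_indic _ (iterC_indic p x))//.
rewrite (hnorm_indic (A := [set x]))//; last exact: (iterC_indic 0).
rewrite -/(mass mu x) -ler_sqr ?nnegrE ?mulr_ge0 ?sqrtr_ge0 ?exprn_ge0//.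
by rewrite exprMn !sqr_sqrtr ?fine_ge0.
Qed.

(* This is C^{*p} C^p, by [iter_adjointC] below. *)
Definition RNmul p (u : L2 mu) : L2 mu :=
  L2_of mu (fun x => (RN mu p x)%:C%C * u x).

Lemma RNmulE p (u : L2 mu) x : RNmul p u x = (RN mu p x)%:C%C * u x.
Proof.
have [B hB] := RN_bounded p.
by rewrite L2_ofE//; exact: (@square_integrable_bounded _ _ _ mu (RN mu p) B u).
Qed.

Lemma mulc_scalel (z w : R[i]) (h : R) :
  (complex.Re (z * conjc (h%:C%C * w)) = complex.Re (z * conjc w) * h) *
  (complex.Im (z * conjc (h%:C%C * w)) = complex.Im (z * conjc w) * h).
Proof. by case: z w => [? ?] [? ?] /=; split; ring. Qed.

Lemma has_adjoint_RNmul p (u : L2 mu) :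
  has_adjoint C (RNmul p (C u)) (RNmul p.+1 u).
Proof.
move=> f; rewrite /L2_dot /integralC.
pose z x := f x * conjc (u x).
(* Both integrals equal that of [h] composed with p + 1 iterates of the parent map. *)
have aux (h : X -> R) : \int[mu]_x (h (phi x) * RN mu p x) =
    \int[mu]_x (h x * RN mu p.+1 x).
  rewrite -(@Rintegral_iter_parent p (h \o phi)); last exact: fiber_fin.
  by rewrite -Rintegral_iter_parent//; exact: fiber_fin.
have := aux (@complex.Re R \o z); have := aux (@complex.Im R \o z).
move=> hI hR; refine (f_equal2 _ _ _).
- rewrite (eq_Rintegral _ (g := fun x => complex.Re (z (phi x)) * RN mu p x)).
    rewrite hR; apply: eq_Rintegral => x _; by rewrite RNmulE mulc_scalel.
  by move=> x _; rewrite RNmulE !hC mulc_scalel.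
- rewrite (eq_Rintegral _ (g := fun x => complex.Im (z (phi x)) * RN mu p x)).
    rewrite hI; apply: eq_Rintegral => x _; by rewrite RNmulE mulc_scalel.
  by move=> x _; rewrite RNmulE !hC mulc_scalel.
Qed.

Lemma L2_dot_indic x (w : L2 mu) :
  L2_dot (L2_of mu (fun y => (\1_[set x] y)%:C%C)) w = (mass mu x)%:C%C * conjc (w x).
Proof.
have E (g : X -> R) : \int[mu]_y (\1_[set x] y * g y) = mass mu x * g x.
  rewrite /Rintegral (_ : (\int[mu]_y _ = (mass mu x * g x)%:E)%E)//.
  transitivity (\int[mu]_(y in [set x]) (cst (g x)%:E y))%E; last first.
    by rewrite integral_cst// massE -EFinM mulrC.
  rewrite [RHS]integral_mkcond; apply: eq_integral => y _.
  rewrite patchE indicE; case: ifPn => [|_]; last by rewrite mul0r.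
  by rewrite inE => ->; rewrite mul1r.
rewrite /L2_dot /integralC; apply/eqP; rewrite eq_complex /=; apply/andP.
split; apply/eqP.
- transitivity (\int[mu]_y (\1_[set x] y * complex.Re (w y))).
    apply: eq_Rintegral => y _; rewrite (iterC_indic 0).
    by case: (w y) => [? ?] /=; ring.
  by rewrite E; case: (w x) => [? ?] /=; ring.
- transitivity (\int[mu]_y (\1_[set x] y * - complex.Im (w y))).
    apply: eq_Rintegral => y _; rewrite (iterC_indic 0).
    by case: (w y) => [? ?] /=; ring.
  by rewrite E; case: (w x) => [? ?] /=; ring.
Qed.

(** Pairing with indicators of points, which have positive mass, determines every value of [w], so
    the set inside [adjoint] is a singleton. *)
Lemma has_adjointE (v w : L2 mu) : has_adjoint C v w -> adjoint dot C v = w.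
Proof.
move=> vw; apply: xget_unique => // w' vw'; apply: L2_ext => x.
have := vw (L2_of mu (fun y => (\1_[set x] y)%:C%C)); rewrite vw' !L2_dot_indic.
move=> /(mulfI _) h; rewrite -[LHS]conjcK -[RHS]conjcK h//.
by rewrite (inj_eq (@complexI R)) gt_eqF// mass_gt0.
Qed.

(** Each adjoint strips one C under every [RNmul] and raises its index by one. Treating the whole
    sum at once lets [has_adjoint_sum] stand in for linearity of [adjoint]. *)
Lemma iter_adjoint_sum k (I : Type) (r : seq I) (c : I -> R[i]) (q : I -> nat)
    (u : L2 mu) :
  iter k (adjoint dot C) (\sum_(i <- r) c i *: RNmul (q i) (iter k C u)) =
  \sum_(i <- r) c i *: RNmul (q i + k) u.
Proof.
elim: k q => [|k IH] q; first by under [RHS]eq_bigr do rewrite addn0.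
rewrite iterSr (@has_adjointE _ (\sum_(i <- r) c i *: RNmul (q i).+1 (iter k C u))).
  by rewrite IH; apply: eq_bigr => i _; rewrite addSnnS.
by apply: has_adjoint_sum => i; exact: has_adjoint_RNmul.
Qed.

Lemma iter_adjointC k (u : L2 mu) :
  iter k (adjoint dot C) (iter k C u) = RNmul k u.
Proof.
have := @iter_adjoint_sum k _ [:: tt] (fun=> 1) (fun=> 0%N) u.
rewrite !big_seq1 !scale1r add0n => <-; congr iter; apply: L2_ext => x.
by rewrite RNmulE RN0 mul1r.
Qed.

Lemma L2_sumE (I : Type) (r : seq I) (c : I -> R[i]) (v : I -> L2 mu) x :
  L2_fun (\sum_(i <- r) c i *: v i) x = \sum_(i <- r) c i * v i x.
Proof.
elim: r => [|i r IH]; first by rewrite !big_nil.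
by rewrite !big_cons [LHS]L2_linE IH.
Qed.

Lemma iter_adjoint_defect k m (u : L2 mu) x :
  iter k (adjoint dot C) (defect dot m C (iter k C u)) x =
  ((-1) ^+ m * bdiff m (RN mu ^~ x) k)%:C%C * u x.
Proof.
rewrite /defect; under eq_bigr do rewrite iter_adjointC.
rewrite iter_adjoint_sum L2_sumE bdiffE mulr_sumr rmorph_sum mulr_suml.
(* [defect] pairs (-1)^j with the power m - j, [bdiff] with the index itself; reversing the sum
   accounts for the factor (-1)^m. *)
rewrite [RHS](reindex_inj rev_ord_inj); apply: eq_bigr => j _ /=.
have jm : (j <= m)%N by rewrite -ltnS.
rewrite subSS RNmulE mulrA; congr (_ * _).
rewrite /=; move: (RN mu (m - j + k) x) => h; rewrite bin_sub// !mulrA -exprD !rmorphM /= rmorphXn rmorphN1 rmorph_nat.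
congr (_ * _ * _); rewrite -[LHS]signr_odd -[RHS]signr_odd oddD oddB//.
by rewrite addbA addbb.
Qed.

(** The operator multiplies by a function, whose value at x is read off from the indicator of x. *)
Lemma quasi_isometryP k m :
  quasi_isometry dot k m C <-> forall x, bdiff m (RN mu ^~ x) k = 0.
Proof.
split=> [h x|h u]; last first.
  by apply: L2_ext => x; rewrite iter_adjoint_defect h mulr0 mul0r.
have := h (L2_of mu (fun y => (\1_[set x] y)%:C%C)).
move=> /(congr1 (fun f : L2 mu => f x)); rewrite iter_adjoint_defect.
rewrite (iterC_indic 0) indicE mem_set// mulr1 => /(@complexI R _ 0)/eqP.
by rewrite mulf_eq0 signr_eq0 => /eqP.
Qed.

Lemma iter_adjoint0 k : iter k (adjoint dot C) 0 = 0.
Proof.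
elim: k => // k IH; rewrite iterS IH; apply: has_adjointE => u.
by rewrite !L2_dot0r.
Qed.

(** The identity for k is taken at [C u] and followed by one more adjoint, which sends 0 to 0. *)
Lemma quasi_isometryS k m :
  quasi_isometry dot k m C -> quasi_isometry dot k.+1 m C.
Proof.
by move=> h u; rewrite iterS [iter k.+1 C u]iterSr h; exact: (iter_adjoint0 1).
Qed.

End VertexMeasure.

(** * Iterates of the parent map and their fibres *)

Section ParentIterates.
Variables (n : nat) (eta : 'I_n.+1 -> option nat).
Local Notation phi := (@parent n eta).

Lemma iter_parent_circ p r :
  iter p phi (circ eta r) = circ eta (iter p (@ord_pred n.+1) r).
Proof. by elim: p => //= p ->. Qed.

Lemma iter_parent_period r : iter n.+1 phi (circ eta r) = circ eta r.
Proof.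
rewrite iter_parent_circ; congr circ; apply/val_inj.
have H p : (iter p (@ord_pred n.+1) r + p = r %[mod n.+1])%N.
  elim: p => [|p IH]; first by rewrite addn0.
  rewrite iterS -IH; set s := iter p _ r.
  by rewrite [val (ord_pred s)]/= modnDml addnS -addSn prednK ?addn_gt0 ?orbT// addnAC modnDr.
have := H n.+1; rewrite modnDr !modn_small//.
Qed.

Lemma iter_parent_branch r (i : branch_index (eta r)) p j :
  iter p phi (branch i (p + j)) = branch i j.
Proof. by elim: p => // p IH; rewrite iterSr addSn. Qed.

Lemma iter_parent_branch_circ r (i : branch_index (eta r)) j :
  iter j.+1 phi (branch i j) = circ eta r.
Proof. by have := iter_parent_branch i j 0; rewrite addn0 iterS => ->. Qed.

Lemma fiber_branch r (i : branch_index (eta r)) p j :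
  fiber p (branch i j) = [set branch i (p + j)].
Proof.
apply/seteqP; split => [x|x ->]; last by rewrite /fiber /= iter_parent_branch.
rewrite /fiber /=; elim: p x j => [|p IH] x j //.
rewrite iterSr => /IH; case: x => [//|r' i' [|j']//=].
(* Applying [s], the shift along branches, to the equation between parents gives the equation
   between vertices, with no inversion of a dependent constructor. *)
pose s (x : vertex eta) := if x is branch r i j then branch i j.+1 else x.
by move/(congr1 s).
Qed.

End ParentIterates.

(** * Radon-Nikodym derivatives on the branches and on the circuit *)

Section CompositionOperator.
Variables (R : realType) (n : nat) (eta : 'I_n.+1 -> option nat).
Variable mu : {measure set (vertex eta) -> \bar R}.
Local Notation phi := (@parent n eta).
Hypothesis mu_gt0 : forall x : vertex eta, (0 < mu [set x])%E.
Hypothesis mu_fin : forall x : vertex eta, (mu [set x] < +oo)%E.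

Lemma RN_branch r (i : branch_index (eta r)) p j :
  RN mu p (branch i j) = mass mu (branch i (p + j)) / mass mu (branch i j).
Proof. by rewrite /RN -/(fiber p _) fiber_branch. Qed.

(** Raising p in [RN] moves the vertex along the branch, so differences in p become differences of
    the mass in its position. *)
Lemma bdiff_RN_branch m k r (i : branch_index (eta r)) j :
  bdiff m (RN mu ^~ (branch i j)) k =
  bdiff m (fun l => mass mu (branch i (k + l))) j / mass mu (branch i j).
Proof.
rewrite !bdiffE mulr_suml; apply: eq_bigr => p _; rewrite RN_branch mulrA.
by rewrite addnA (addnC k).
Qed.

(* phi^{-(p+n+1)}(x_r) contains phi^{-p}(x_r), since the circuit has length n+1,
   and also the vertex [branch i (p + n)]. *)
Lemma RN_period r (i : branch_index (eta r)) p :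
  (forall q, (mu (fiber q (circ eta r)) < +oo)%E) ->
  RN mu p (circ eta r) + mass mu (branch i (p + n)) / mass mu (circ eta r) <=
  RN mu (p + n.+1) (circ eta r).
Proof.
move=> fin; rewrite /RN -mulrDl ler_wpM2r//.
  by rewrite invr_ge0 ltW// mass_gt0.
rewrite -!/(fiber _ _) -lee_fin EFinD -massE// !fineK ?ge0_fin_numE ?fin//.
rewrite -measureU//; last first.
  apply/seteqP; split => // x [/= + xb]; rewrite /fiber /= xb.
  by rewrite iter_parent_branch.
apply: le_measure; rewrite ?inE// => x [|->]; rewrite /fiber /=.
  by rewrite addnC iterD => ->; rewrite iter_parent_period.
by rewrite addnS iter_parent_branch_circ.
Qed.

End CompositionOperator.

Theorem theorem2p6 (R : realType) (m k n : nat) (eta : 'I_n.+1 -> option nat)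
    (mu : {sigma_finite_measure set (vertex eta) -> \bar R})
    (C : L2 mu -> L2 mu)
    (hm : (2 <= m)%N)
    (heta : exists r, eta r <> Some 0%N)
    (hmu : forall x : vertex eta, (0 < mu [set x])%E)
    (hC : is_composition_operator C)
    (hbounded : bounded_operator (@L2_dot _ _ _ mu) C) :
  quasi_isometry (@L2_dot _ _ _ mu) k m C <->
  ((forall (r : 'I_n.+1) (i : branch_index (eta r)),
      polynomial_seq (m - 2) (fun j => mass mu (branch i (k + j)))) /\
   (forall r : 'I_n.+1,
      \sum_(p < m.+1) (-1) ^+ p * 'C(m, p)%:R * RN mu (p + k) (circ eta r)
      = 0)).
Proof.
have mu_fin x : (mu [set x] < +oo)%E.
  have [F FT Ffin] := sigma_finiteT mu.
  have [i _ Fix] : (\bigcup_i F i) x by rewrite -FT.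
  have [mF] := Ffin i; apply: le_lt_trans; apply: le_measure; rewrite ?inE//.
  by move=> y ->.
(* The degree bound m - 2 is d, so (a) is the vanishing of differences of order d + 1, one less than
   m. *)
have [d md] : exists d, m = d.+2 by exists m.-2; case: m hm => [|[]].
rewrite md subn2 /= in hm *.
have qP := quasi_isometryP hmu mu_fin hC hbounded.
split=> [hq|[ha hb]]; last first.
  apply/qP => -[r|r i j]; first by rewrite bdiffE.
  have /polynomial_seqP hp := ha r i.
  by rewrite bdiff_RN_branch bdiffS !hp subrr mul0r.
split=> [r i|r]; last by have /qP/(_ (circ eta r)) := hq; rewrite bdiffE.
(* Raising k extends the vanishing at a circuit vertex from the index k to all k + l. *)
have hq' l : quasi_isometry (@L2_dot _ _ _ mu) (k + l) d.+2 C.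
  elim: l => [|l IH]; first by rewrite addn0.
  by rewrite addnS; exact: (quasi_isometryS hmu mu_fin hC IH).
have hRN l x : bdiff d.+2 (RN mu ^~ x) (k + l) = 0.
  by have /qP := hq' l; exact.
pose g j := mass mu (branch i (k + j)).
pose h p := RN mu (k + p) (circ eta r).
have g2 j : bdiff d.+2 g j = 0.
  have /qP/(_ (branch i j))/eqP := hq; rewrite bdiff_RN_branch mulf_eq0 => /orP[/eqP//|].
  by rewrite invr_eq0 gt_eqF// mass_gt0.
have h2 j : bdiff d.+2 h j = 0.
  rewrite -(hRN j (circ eta r)) !bdiffE; apply: eq_bigr => p _.
  by rewrite /h addnCA.
have cst1 (s : nat -> R) j : (forall j, bdiff d.+2 s j = 0) -> bdiff d.+1 s j = bdiff d.+1 s 0%N.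
  by move=> s2; apply: bdiff_const => l; rewrite [LHS]/= -[RHS](s2 l) bdiffS.
(* This is the constant forward difference of order d + 1 of [g]; it is to be shown zero. *)
pose c := (-1) ^+ d.+1 * bdiff d.+1 g 0%N.
have c0 : 0 <= c.
  apply: (@bdiff_ge0 _ d.+1 g) => [j|j]; last by rewrite (cst1 g).
  by rewrite ltW// mass_gt0.
pose a := (mass mu (circ eta r))^-1.
have a0 : 0 < a by rewrite invr_gt0 mass_gt0.
(* The sequence below is nonnegative by [RN_period]. In its difference of order d + 1 the two terms
   in [h] are the same constant and cancel, which leaves -ac. *)
have cN : 0 <= - (a * c).
  apply: (@bdiff_ge0 _ d.+1 (fun j => h (j + n.+1)%N - h j - a * g (j + n)%N)) => j.
    rewrite /h /g -addrA -opprD subr_ge0 addnA mulrC addnA.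
    apply: RN_period => // q; exact: (fiber_fin mu_fin hC).
  rewrite !bdiffB bdiffZ !bdiff_shift !(cst1 h)// (cst1 g)// subrr sub0r.
  by rewrite /c; ring.
have {c0 cN} c0 : c = 0 by apply/eqP; rewrite eq_le c0 andbT; nra.
apply/polynomial_seqP => j; rewrite -/g (cst1 g)//.
by move/eqP: c0; rewrite mulf_eq0 signr_eq0 => /eqP.
Qed.
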